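(* Let $\mathcal D$ and $\mathcal C$ be as in the context (a locally finite commutative variety $\mathcal D$ whose epimorphisms are surjective, and a locally finite variety $\mathcal C$ predual to it, with the output objects having two-element underlying sets), let $X_0$ be a finite alphabet and $X=\Psi X_0$. Let $L:X^*\to Y$ be a regular language, and let $V_L$ be the smallest local variety of languages over $X_0$ in $\mathcal C$ containing the reversed language $L^{\mathrm{rev}}$. Then $V_L$ is finite, and the syntactic $\mathcal D$-monoid $\mathrm{Syn}(L)$ is dual to $V_L$: the dual $F$-algebra $\widehat{V_L}$ is isomorphic to the $F$-algebra derived from the $X_0$-generated $\mathcal D$-monoid $e_L:X^*\to\mathrm{Syn}(L)$ (carrier $\mathrm{Syn}(L)$, initial state the unit, transitions $\delta_a(m)=e_L(a)\bullet m$ for $a\in X_0$).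
   Context: $\mathcal D$ is a variety of algebras or ordered algebras that is commutative (for all $A,B$ the homomorphisms $A\to B$ form a subalgebra $[A,B]$ of $B^{|A|}$), locally finite (finitely generated algebras are finite) and whose epimorphisms are surjective; $\otimes$ represents bimorphisms and $I=\Psi 1$, where $\Psi$ is the free-algebra functor. $\mathcal C$ is a locally finite variety of algebras such that the full subcategories $\mathcal C_f,\mathcal D_f$ of finite algebras are dually equivalent via $Q\mapsto\widehat Q$, $g\mapsto\widehat g$. $\bar I\in\mathcal C$ is the free one-generated algebra, $Y\in\mathcal D_f$ is dual to $\bar I$, $\bar Y\in\mathcal C_f$ is dual to $I$; both $|Y|$ and $|\bar Y|$ are identified with $\{0,1\}$. $X^*=\Psi X_0^*$ is the free $\mathcal D$-monoid on $X$; a language $L:X^*\to Y$ is identified with its restriction $X_0^*\to\{0,1\}$; its reversal is $L^{\mathrm{rev}}=L\circ\mathrm{rev}$, with $\mathrm{rev}:X^*\to X^*$ extending word reversal. $L$ is regular if accepted by a $\mathcal D$-automaton (object $Q$, endomorphisms $\delta_a$, $a\in X_0$, initial state $i\in Q$, output morphism $f:Q\to Y$) with finite $Q$. $F$-algebras are $(A,\delta_a\ (a\in X_0),i:I\to A)$ in $\mathcal D$. On $\mathcal C$, $\bar TQ=\bar Y\times Q^{X_0}$; coalgebras are $(Q,\gamma_a\ (a\in X_0),f:Q\to\bar Y)$. The dual $F$-algebra of a finite $\bar T$-coalgebra $(Q,\gamma_a,f)$ is $(\widehat Q,\widehat{\gamma_a},\widehat f:I\cong\widehat{\bar Y}\to\widehat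 Q)$. The rational coalgebra $\rho\bar T$ is the colimit of all finite $\bar T$-coalgebras; its states are the regular languages over $X_0$ (each state of a finite coalgebra mapped to the language it accepts, $a_1\cdots a_n\mapsto f\gamma_{a_n}\cdots\gamma_{a_1}(q)$), with output $K\mapsto[\epsilon\in K]$ and transitions $K\mapsto a^{-1}K=\{w:aw\in K\}$. A subcoalgebra of $\rho\bar T$ is a $\bar T$-coalgebra whose unique homomorphism into $\rho\bar T$ is injective; a local variety of languages over $X_0$ in $\mathcal C$ is a subcoalgebra $V$ of $\rho\bar T$ closed under right derivatives $K\mapsto Ka^{-1}=\{w:wa\in K\}$. An $X_0$-generated $\mathcal D$-monoid is a surjective $\mathcal D$-monoid morphism $e:X^*\to M$; $\mathrm{Syn}(L)$ is the one recognizing $L$ (i.e. $L=g\circ e$ for some $g:M\to Y$) that factors through all others recognizing $L$.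
   Formalization: Transitions of the derived F-algebra are m·e_L(a), not e_L(a)·m; the latter is false (sets/Boolean algebras, L = aX* ). The identifications of |Y| and |Ȳ| with {0,1} are taken to agree along the bijection induced by the duality. *)

(* Defs.v *)
From mathcomp Require Import all_boot.
From mathcomp Require Import boolp classical_sets functions cardinality.

Set Implicit Arguments.
Unset Strict Implicit.
Unset Printing Implicit Defensive.

Local Open Scope classical_set_scope.

Record signature := Signature { op : Type; arity : op -> nat }.

(* An ordered algebra: a poset with monotone operations.  An unordered algebra
   is the same thing as an ordered algebra whose order is equality; monotone
   homomorphisms, inequations and pointwise orders then specialize to plain
   homomorphisms, equations and nothing at all.  See [in_variety]. *)
Record algebra (S : signature) := Algebra {
  carrier :> Type;
  ale : carrier -> carrier -> Prop;
  ale_refl : forall x, ale x x;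
  ale_trans : forall x y z, ale x y -> ale y z -> ale x z;
  ale_anti : forall x y, ale x y -> ale y x -> x = y;
  ap : forall o : op S, ('I_(arity o) -> carrier) -> carrier;
  ap_mono : forall (o : op S) (u v : 'I_(arity o) -> carrier),
    (forall i, ale (u i) (v i)) -> ale (ap u) (ap v)
}.
Arguments ap {S} a o u.

Inductive term (S : signature) :=
| Var of nat
| App (o : op S) of ('I_(arity o) -> term S).

Fixpoint eval (S : signature) (A : algebra S) (v : nat -> A) (t : term S) : A :=
  match t with
  | Var n => v n
  | App o ts => ap A o (fun i => eval v (ts i))
  end.

(* [axioms V s t] reads "s <= t" when [V] is a variety of ordered algebras and
   "s = t" when it is a variety of algebras. *)
Record variety := Variety {
  vsig :> signature;
  is_ordered : bool;
  axioms : term vsig -> term vsig -> Prop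
}.

Definition in_variety (V : variety) (A : algebra V) : Prop :=
  (is_ordered V = false -> forall x y : A, ale x y -> x = y) /\
  (forall s t, axioms s t -> forall v : nat -> A, ale (eval v s) (eval v t)).

Record obj (V : variety) := Obj {
  obj_alg :> algebra V;
  obj_in : in_variety obj_alg
}.

Record fobj (V : variety) := FObj {
  fobj_obj :> obj V;
  fobj_fin : finite_set [set: fobj_obj]
}.

Definition is_hom (S : signature) (A B : algebra S) (f : A -> B) : Prop :=
  (forall o u, f (ap A o u) = ap B o (f \o u)) /\
  (forall x y, ale x y -> ale (f x) (f y)).

Record hom (S : signature) (A B : algebra S) := Hom {
  hom_fun :> A -> B;
  hom_is : is_hom hom_fun
}.

Lemma is_hom_id (S : signature) (A : algebra S) : is_hom (fun x : A => x).
Proof. by split. Qed.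

Lemma is_hom_comp (S : signature) (A B C : algebra S) (g : hom B C)
  (f : hom A B) : is_hom (fun x => g (f x)).
Proof.
case: g f => g [g_op g_le] [f [f_op f_le]]; split=> /= [o u|x y xy].
  by rewrite f_op g_op.
by apply: g_le; apply: f_le.
Qed.

Definition hid (S : signature) (A : algebra S) : hom A A := Hom (is_hom_id A).

Definition hcomp (S : signature) (A B C : algebra S) (g : hom B C)
  (f : hom A B) : hom A C := Hom (is_hom_comp g f).

Record iso (S : signature) (A B : algebra S) := Iso {
  iso_hom :> hom A B;
  iso_inv : hom B A;
  iso_homK : cancel iso_hom iso_inv;
  iso_invK : cancel iso_inv iso_hom
}.

Definition surj (T U : Type) (f : T -> U) : Prop := forall y, exists x, f x = y.

Definition subalgebra (S : signature) (A : algebra S) (P : set A) : Prop :=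
  forall o u, (forall i, P (u i)) -> P (ap A o u).

Definition finitely_generated (S : signature) (A : algebra S) : Prop :=
  exists G : set A, finite_set G /\
    forall P : set A, G `<=` P -> subalgebra P -> [set: A] `<=` P.

Definition locally_finite (V : variety) : Prop :=
  forall A : obj V, finitely_generated A -> finite_set [set: A].

(* The homomorphisms A -> B are closed under the pointwise operations of the
   power of B by the set |A|. *)
Definition commutative_variety (V : variety) : Prop :=
  forall (A B : obj V) (o : op V) (h : 'I_(arity o) -> hom A B),
    is_hom (fun x : A => ap B o (fun i => h i x)).

Definition epimorphism (V : variety) (A B : obj V) (f : hom A B) : Prop :=
  forall (Z : obj V) (g h : hom B Z),
    (forall x, g (f x) = h (f x)) -> forall y, g y = h y.

Definition epis_surjective (V : variety) : Prop :=
  forall (A B : obj V) (f : hom A B), epimorphism f -> surj f.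

Definition is_free (V : variety) (T : Type) (A : obj V) (eta : T -> A) : Prop :=
  forall (B : obj V) (h : T -> B), exists f : hom A B,
    (forall t, f (eta t) = h t) /\
    (forall g : hom A B, (forall t, g (eta t) = h t) -> forall x, g x = f x).

Definition free_ext (V : variety) (T : Type) (A : obj V) (eta : T -> A)
    (free : is_free eta) (B : obj V) (h : T -> B) : hom A B :=
  projT1 (cid (free B h)).

Record dual_equivalence (C D : variety) := DualEquivalence {
  hatO : fobj C -> fobj D;
  hatM : forall P Q : fobj C, hom P Q -> hom (hatO Q) (hatO P);
  hatM_id : forall (P : fobj C) x, hatM (hid P) x = x;
  hatM_comp : forall (P Q R : fobj C) (g : hom Q R) (f : hom P Q) x,
    hatM (hcomp g f) x = hatM f (hatM g x);
  chkO : fobj D -> fobj C;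
  chkM : forall A B : fobj D, hom A B -> hom (chkO B) (chkO A);
  chkM_id : forall (A : fobj D) x, chkM (hid A) x = x;
  chkM_comp : forall (A B E : fobj D) (g : hom B E) (f : hom A B) x,
    chkM (hcomp g f) x = chkM f (chkM g x);
  chk_hat : forall P : fobj C, iso P (chkO (hatO P));
  chk_hat_nat : forall (P Q : fobj C) (f : hom P Q) x,
    chk_hat Q (f x) = chkM (hatM f) (chk_hat P x);
  hat_chk : forall A : fobj D, iso A (hatO (chkO A));
  hat_chk_nat : forall (A B : fobj D) (f : hom A B) x,
    hat_chk B (f x) = hatM (chkM f) (hat_chk A x)
}.

Record predual (C D : variety) := Predual {
  dual :> dual_equivalence C D;

  unitI : fobj D;
  genI : unitI;
  unitI_free : is_free (fun _ : unit => genI);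

  Ibar : fobj C;
  genIbar : Ibar;
  Ibar_free : is_free (fun _ : unit => genIbar);

  outY : fobj D;
  outY_dual : iso (hatO dual Ibar) outY;

  Ybar : fobj C;
  Ybar_dual : iso unitI (hatO dual Ybar);

  bitY : outY -> bool;
  bitY_bij : bijective bitY;
  bitYbar : Ybar -> bool;
  bitYbar_bij : bijective bitYbar;
  (* The two identifications with {0,1} agree along the canonical bijection
     |Ybar| = C(Ibar, Ybar) = D(I, Y) = |Y| induced by the duality; otherwise
     one could silently complement all languages on one side. *)
  bit_compat : forall h : hom Ibar Ybar,
    bitYbar (h genIbar) = bitY (outY_dual (hatM dual h (Ybar_dual genI)))
}.

(* Bimorphisms M x M -> M are the morphisms from the tensor product M (x) M, and
   elements of M are the morphisms I -> M, so this is a monoid in (D, (x), I). *)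
Definition bimorphism (S : signature) (A B C : algebra S) (f : A -> B -> C) :=
  (forall a, is_hom (f a)) /\ (forall b, is_hom (fun a => f a b)).

Record dmonoid (D : variety) := DMonoid {
  dm_obj :> obj D;
  mul : dm_obj -> dm_obj -> dm_obj;
  one : dm_obj;
  mulA : forall x y z, mul x (mul y z) = mul (mul x y) z;
  mul1m : forall x, mul one x = x;
  mulm1 : forall x, mul x one = x;
  mul_bimorphism : bimorphism mul
}.
Arguments one {D} d.

Record mhom (D : variety) (M N : dmonoid D) := MHom {
  mhom_hom :> hom M N;
  mhom_mul : forall x y, mhom_hom (mul x y) = mul (mhom_hom x) (mhom_hom y);
  mhom_one : mhom_hom (one M) = one N
}.

(* The D-monoid X^* on X = Psi X0: the free algebra on the set of words, with
   the multiplication extending concatenation. *)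
Record free_dmonoid (D : variety) (X0 : finType) := FreeDMonoid {
  fdm :> dmonoid D;
  word : seq X0 -> fdm;
  word_free : is_free word;
  word_nil : word [::] = one fdm;
  word_cat : forall u v, word (u ++ v) = mul (word u) (word v)
}.
Arguments word {D X0} f _.

Section Languages.
Variables (C D : variety) (E : predual C D) (X0 : finType).

Section FreeMonoid.
Variable Xs : free_dmonoid D X0.

Definition word_language (L : hom Xs (outY E)) (w : seq X0) : bool :=
  bitY (L (word Xs w)).

Definition revX : hom Xs Xs :=
  free_ext (word_free Xs) (fun w : seq X0 => word Xs (rev w)).

Definition reversal (L : hom Xs (outY E)) : hom Xs (outY E) := hcomp L revX.

Definition regular (L : hom Xs (outY E)) : Prop :=
  exists (Q : fobj D) (delta : X0 -> hom Q Q) (i : Q) (f : hom Q (outY E)),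
    forall w : seq X0,
      L (word Xs w) = f (foldl (fun q a => delta a q) i w).

Definition recognizes (M : dmonoid D) (e : mhom Xs M) (L : hom Xs (outY E)) :=
  exists g : hom M (outY E), forall x, L x = g (e x).

Definition is_syntactic (L : hom Xs (outY E)) (M : dmonoid D) (e : mhom Xs M) :=
  [/\ surj e, recognizes e L &
      forall (N : dmonoid D) (e' : mhom Xs N), surj e' -> recognizes e' L ->
        exists h : mhom N M, forall x, e x = h (e' x)].

End FreeMonoid.

Record falg := FAlg {
  fa_obj :> obj D;
  fa_delta : X0 -> hom fa_obj fa_obj;
  fa_init : hom (unitI E) fa_obj
}.

Definition falg_isomorphic (A B : falg) : Prop :=
  exists phi : iso A B,
    (forall a x, phi (fa_delta A a x) = fa_delta B a (phi x)) /\
    (forall x, phi (fa_init A x) = fa_init B x).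

(* The transitions multiply on the right, so that the state reached from the
   unit by reading a word w letter by letter is e(w).  The side matters: dual
   F-algebras reverse words (the languages of the states of Q are the
   languages recognized through [dual_falg Q], read backwards), and with
   transitions e(a) m one would get the dual of the local variety of L instead
   of that of its reversal. *)
Definition derived_falg (Xs : free_dmonoid D X0) (M : dmonoid D)
    (e : mhom Xs M) : falg :=
  {| fa_obj := M;
     fa_delta := fun a => Hom ((mul_bimorphism M).2 (e (word Xs [:: a])));
     fa_init := free_ext (unitI_free E) (fun _ => one M) |}.

Record coalg := Coalg {
  ca_obj :> obj C;
  ca_gamma : X0 -> hom ca_obj ca_obj;
  ca_out : hom ca_obj (Ybar E)
}.

Record coalg_hom (P Q : coalg) := CoalgHom {
  ch_hom :> hom P Q;
  ch_gamma : forall a x, ch_hom (ca_gamma P a x) = ca_gamma Q a (ch_hom x);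
  ch_out : forall x, ca_out Q (ch_hom x) = ca_out P x
}.

Definition accepted (Q : coalg) (q : Q) (w : seq X0) : bool :=
  bitYbar (ca_out Q (foldl (fun p a => ca_gamma Q a p) q w)).

Definition dual_falg (Q : coalg) (fin : finite_set [set: Q]) : falg :=
  let FQ := FObj fin in
  {| fa_obj := hatO E FQ;
     fa_delta := fun a => @hatM _ _ E FQ FQ (ca_gamma Q a);
     fa_init := hcomp (@hatM _ _ E FQ (Ybar E) (ca_out Q)) (Ybar_dual E) |}.

(* The colimit, in the category of coalgebras, of all finite coalgebras.  Its
   states are the regular languages: a state r is the language [accepted r]. *)
Record rational_coalgebra := RationalCoalgebra {
  rho :> coalg;
  rho_in : forall Q : coalg, finite_set [set: Q] -> coalg_hom Q rho;
  rho_cocone : forall (P Q : coalg) (finP : finite_set [set: P])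
      (finQ : finite_set [set: Q]) (h : coalg_hom P Q) x,
    rho_in finQ (h x) = rho_in finP x;
  rho_universal : forall (Z : coalg)
      (d : forall Q : coalg, finite_set [set: Q] -> coalg_hom Q Z),
    (forall (P Q : coalg) (finP : finite_set [set: P])
        (finQ : finite_set [set: Q]) (h : coalg_hom P Q) x,
      d Q finQ (h x) = d P finP x) ->
    exists u : coalg_hom rho Z,
      (forall (Q : coalg) (finQ : finite_set [set: Q]) x,
        u (rho_in finQ x) = d Q finQ x) /\
      (forall u' : coalg_hom rho Z,
        (forall (Q : coalg) (finQ : finite_set [set: Q]) x,
          u' (rho_in finQ x) = d Q finQ x) ->
        forall r, u' r = u r)
}.

Definition contains (V : coalg) (K : seq X0 -> bool) : Prop :=
  exists v : V, accepted v =1 K.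

Definition subcoalgebra (R : rational_coalgebra) (V : coalg) : Prop :=
  exists m : coalg_hom V R,
    injective m /\ (forall m' : coalg_hom V R, forall v, m' v = m v).

Definition local_variety (R : rational_coalgebra) (V : coalg) : Prop :=
  subcoalgebra R V /\
  forall (v : V) (a : X0), contains V (fun w => accepted v (rcons w a)).

Definition smallest_local_variety (R : rational_coalgebra)
    (K : seq X0 -> bool) (V : coalg) : Prop :=
  [/\ local_variety R V, contains V K &
      forall W : coalg, local_variety R W -> contains W K ->
        forall v : V, contains W (accepted v)].

End Languages.

(* Main.v *)
(* Syn(L) is the image of X^* in the power of Y indexed by pairs of words, under
   x |-> (L (u x v))_(u,v); it is finite because L is regular.  Hence it is, as
   an F-algebra, the dual of a finite coalgebra Z, whose states correspond to
   the morphisms g : Syn(L) -> Y, the state g accepting the reversal of g e_L.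
   So Z is a local variety containing L^rev, and V_L embeds into Z.  The dual
   t : Syn(L) -> hat V_L of this embedding is an epimorphism, since the states
   of V_L are separated by their languages, hence t is surjective; and t
   reflects the order, since V_L contains all two-sided derivatives of L^rev,
   i.e. all coordinates of Syn(L) factor through t.  Thus t is an isomorphism.

   That states of rho T are determined by their languages is derived from the
   universal property: every state is the image of a state of a finite
   coalgebra, and two such states with equal languages are identified in a
   finite subcoalgebra of the final coalgebra of all languages. *)

Require Import Defs.
From mathcomp Require Import all_boot.
From mathcomp Require Import boolp classical_sets functions cardinality.

Local Open Scope classical_set_scope.

Set Implicit Arguments.
Unset Strict Implicit.
Unset Printing Implicit Defensive.

(* The MathComp imports rebind these names. *)
Local Notation surj := Defs.surj.
Local Notation mul := Defs.mul.
Local Notation one := Defs.one.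

(** A function is determined by its list of values along an enumeration [s] of [T], and there are
    finitely many lists of length [size s] over [U]. *)
Lemma finite_fun (T U : Type) :
  finite_set [set: T] -> finite_set [set: U] -> finite_set [set: T -> U].
Proof.
move=> finT finU.
have [s sE] := (@finite_seqP {classic T} _).1 finT.
have finS n : finite_set [set t : seq U | size t = n].
  elim: n => [|n IH].
    by apply: (sub_finite_set _ (finite_set1 [::])) => t /size0nil.
  apply: (sub_finite_set _ (finite_image2 cons finU IH)) => -[|x t] //= [tn].
  by exists x => //; exists t.
apply: (sub_finite_set _ (@finite_preimage _ _ _ (fun f => map f s) _
  (finS (size s)))).
  by move=> f _ /=; rewrite /preimage/= size_map.
move=> f g _ _ fg; apply: funext => x.
have : [set` s] x by rewrite -sE.
by move=> /= xs; have /eq_in_map := fg; apply.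
Qed.

(** * Ordered algebras and varieties *)

Section Algebras.
Variable S : signature.
Implicit Types A B : algebra S.

Lemma hom_eq A B (f g : hom A B) : f =1 g -> f = g.
Proof.
case: f g => [f fP] [g gP] /= /funext fg.
by subst g; congr Hom; exact: Prop_irrelevance.
Qed.

Lemma hom_ap A B (f : hom A B) (o : op S) u : f (ap A o u) = ap B o (f \o u).
Proof. exact: (hom_is f).1. Qed.

Lemma hom_le A B (f : hom A B) (x y : A) : ale x y -> ale (f x) (f y).
Proof. exact: (hom_is f).2. Qed.

Lemma hom_eval A B (f : hom A B) (v : nat -> A) (t : term S) :
  f (eval v t) = eval (f \o v) t.
Proof.
elim: t => //= o ts IH; rewrite hom_ap; congr (ap B o _).
by apply: funext => i /=; exact: IH.
Qed.

Lemma subalgebra_preimage A B (f : hom A B) (P : set B) :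
  subalgebra P -> subalgebra (f @^-1` P).
Proof. by move=> Psub o u Pu; rewrite /preimage/= hom_ap; exact: Psub. Qed.

Lemma subalgebra_image A B (f : hom A B) (P : set A) :
  subalgebra P -> subalgebra (f @` P).
Proof.
move=> Psub o u fPu.
have /choice[v vP] i : exists x, P x /\ f x = u i.
  by have [x Px <-] := fPu i; exists x.
exists (ap A o v); first by apply: Psub => i; exact: (vP i).1.
by rewrite hom_ap; congr (ap B o _); apply: funext => i; exact: (vP i).2.
Qed.

(** Reflecting the order gives injectivity, by antisymmetry, and also monotonicity of the inverse,
    which bijectivity alone would not provide. *)
Lemma iso_of_surj_embedding A B (f : hom A B) : surj f ->
  (forall x y, ale (f x) (f y) -> ale x y) ->
  exists i : iso B A, cancel f i.
Proof.
move=> fS fE.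
pose g (y : B) : A := projT1 (cid (fS y)).
have gK : cancel g f by move=> y; rewrite /g; case: cid.
have fI x y : f x = f y -> x = y.
  by move=> xy; apply: (@ale_anti _ A); apply: fE; rewrite xy; exact: ale_refl.
have fK : cancel f g by move=> x; apply: fI; rewrite gK.
have gh : is_hom g.
  split=> [o u|x y xy].
    apply: fI; rewrite gK hom_ap; congr (ap B o _).
    by apply: funext => i /=; rewrite gK.
  by apply: fE; rewrite !gK.
by exists (@Iso _ B A (Hom gh) f gK fK).
Qed.

Definition generated A (G : set A) : set A :=
  [set x | forall P : set A, G `<=` P -> subalgebra P -> P x].

Lemma generated_sub A (G : set A) : G `<=` generated G.
Proof. by move=> x Gx P GP _; exact: GP. Qed.

Lemma generated_subalgebra A (G : set A) : subalgebra (generated G).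
Proof. by move=> o u Gu P GP Psub; apply: (Psub) => i; exact: Gu. Qed.

Lemma generated_stable A (f : hom A A) (G : set A) :
  (forall x, G x -> G (f x)) -> forall x, generated G x -> generated G (f x).
Proof.
move=> Gf x xG; apply: (xG (f @^-1` generated G)).
  by move=> y /Gf; exact: generated_sub.
exact: (subalgebra_preimage (@generated_subalgebra A G)).
Qed.

Section Subalgebra.
Variables (A : algebra S) (P : set A) (Psub : subalgebra P).

Definition subalg_alg : algebra S.
Proof.
refine (@Algebra S {x : A | P x} (fun x y => ale (sval x) (sval y)) _ _ _
  (fun o u => exist _ (ap A o (fun i => sval (u i)))
                (Psub (fun i => svalP (u i)))) _).
- by move=> x; exact: ale_refl.
- by move=> x y z; exact: ale_trans.
- by move=> [x Px] [y Py] xy yx; apply: eq_exist; exact: ale_anti.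
- by move=> o u v uv; exact: ap_mono.
Defined.

Lemma subalg_incl_is_hom : @is_hom S subalg_alg A (fun x => sval x).
Proof. by []. Qed.

End Subalgebra.

Section Power.
Variables (B : algebra S) (I : Type).

Definition power_alg : algebra S.
Proof.
refine (@Algebra S (I -> B) (fun f g => forall i, ale (f i) (g i)) _ _ _
  (fun o u => fun i => ap B o (fun k => u k i)) _).
- by move=> f i; exact: ale_refl.
- by move=> f g h fg gh i; exact: ale_trans (fg i) (gh i).
- by move=> f g fg gf; apply: funext => i; exact: ale_anti.
- by move=> o u v uv i; apply: ap_mono => k; exact: uv.
Defined.

Lemma power_proj_is_hom (i : I) : @is_hom S power_alg B (fun f => f i).
Proof. by split=> // f g; apply. Qed.

End Power.

End Algebras.

Section Varieties.
Variable V : variety.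

Lemma subalg_in_variety (A : obj V) (P : set A) (Psub : subalgebra P) :
  @in_variety V (subalg_alg Psub).
Proof.
case: (obj_in A) => Aord Aax; split=> [unord [x Px] [y Py] xy|s t st v].
  by apply: eq_exist; exact: Aord.
have := Aax s t st (sval \o v).
by rewrite -!(hom_eval (Hom (subalg_incl_is_hom Psub))).
Qed.

Definition subobj (A : obj V) (P : set A) (Psub : subalgebra P) : obj V :=
  Obj (subalg_in_variety Psub).

Definition subobj_incl (A : obj V) (P : set A) (Psub : subalgebra P) :
  hom (subobj Psub) A := Hom (subalg_incl_is_hom Psub).

Lemma subobj_incl_inj (A : obj V) (P : set A) (Psub : subalgebra P) :
  injective (subobj_incl Psub).
Proof. by move=> [x Px] [y Py]; exact: eq_exist. Qed.

Definition corestr (A B : obj V) (P : set B) (Psub : subalgebra P)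
    (f : hom A B) (Pf : forall x, P (f x)) : hom A (subobj Psub).
Proof.
refine (@Hom V A (subobj Psub) (fun x => exist _ (f x) (Pf x)) _).
split=> [o u|x y xy]; last exact: hom_le.
by apply: eq_exist; exact: hom_ap.
Defined.

Lemma power_in_variety (B : obj V) (I : Type) : @in_variety V (power_alg B I).
Proof.
case: (obj_in B) => Bord Bax; split=> [unord f g fg|s t st v i].
  by apply: funext => i; exact: Bord.
have := Bax s t st (fun n => v n i).
by rewrite -[X in ale X _](hom_eval (Hom (power_proj_is_hom B i)))
  -[X in ale _ X](hom_eval (Hom (power_proj_is_hom B i))).
Qed.

Definition power (B : obj V) (I : Type) : obj V := Obj (power_in_variety B I).

Lemma unordered_is_hom (A B : obj V) (f : A -> B) : is_ordered V = false ->
  (forall o u, f (ap A o u) = ap B o (f \o u)) -> is_hom f.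
Proof.
move=> unord f_ap; split=> // x y /((obj_in A).1 unord) ->.
exact: ale_refl.
Qed.

Lemma free_ext_eta (T : Type) (A : obj V) (eta : T -> A) (free : is_free eta)
  (B : obj V) (h : T -> B) t : free_ext free h (eta t) = h t.
Proof. by rewrite /free_ext; case: cid => f [fh _] /=. Qed.

Lemma free_hom_eq (T : Type) (A : obj V) (eta : T -> A) (free : is_free eta)
  (B : obj V) (f g : hom A B) : (forall t, f (eta t) = g (eta t)) -> f =1 g.
Proof.
move=> fg x; have [h [_ h_uniq]] := free B (g \o eta).
by rewrite (h_uniq f fg) (h_uniq g).
Qed.

(** The extension of [eta] to a morphism into the subalgebra [P], followed by the inclusion, fixes
    the generators and is therefore the identity. *)
Lemma free_generated (T : Type) (A : obj V) (eta : T -> A)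
    (free : is_free eta) (P : set A) :
  subalgebra P -> (forall t, P (eta t)) -> forall x, P x.
Proof.
move=> Psub Peta x.
have [f [f_eta _]] :=
  free (subobj Psub) (fun t => exist _ (eta t) (Peta t)).
have fE : hcomp (subobj_incl Psub) f =1 hid A.
  by apply: (free_hom_eq free) => t /=; rewrite f_eta.
by rewrite -[x]fE; exact: svalP (f x).
Qed.

Lemma subobj_generated_ind (A : obj V) (G : set A)
    (P : set (subobj (@generated_subalgebra _ A G))) :
  (forall x (Gx : G x), P (exist _ x (generated_sub Gx))) -> subalgebra P ->
  forall x, P x.
Proof.
move=> GP Psub [x xG].
(* The membership proof is quantified existentially, so that [P] becomes a subset of [A] itself;
   proof irrelevance recovers the given proof at the end. *)
have : [set y | exists yG : generated G y, P (exist _ y yG)] x.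
  apply: (xG) => [y Gy|o u uP]; first by exists (generated_sub Gy).
  pose v i : subobj (@generated_subalgebra _ A G) :=
    exist _ (u i) (projT1 (cid (uP i))).
  exists (generated_subalgebra (fun i => svalP (v i))).
  have := Psub o v; apply=> i.
  by rewrite /v; case: cid.
by case=> xG'; rewrite (Prop_irrelevance xG xG').
Qed.

Lemma finite_generated (A : obj V) (G : set A) : locally_finite V ->
  finite_set G -> finite_set [set: subobj (@generated_subalgebra _ A G)].
Proof.
move=> lf finG; set Gsub := @generated_subalgebra _ A G.
apply: lf; exists (subobj_incl Gsub @^-1` G); split.
  apply: finite_preimage => // x y _ _; exact: subobj_incl_inj.
move=> P GP Psub x _; apply: subobj_generated_ind => // y Gy; exact: GP.
Qed.

End Varieties.

(** * Coalgebras and the rational coalgebra *)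

Section Coalgebras.
Variables (C D : variety) (E : predual C D) (X0 : finType).
Implicit Types P Q : coalg E X0.

(** The accepted language before outputs are turned into bits: with values in the algebra [Ybar E]
    it depends homomorphically on the state. *)
Definition behavior Q (q : Q) (w : seq X0) : Ybar E :=
  ca_out Q (foldl (fun p a => ca_gamma Q a p) q w).

Lemma eq_accepted P Q (p : P) (q : Q) :
  accepted p =1 accepted q <-> behavior p = behavior q.
Proof.
split=> [pq|pq w]; last by rewrite -[accepted p w]/(bitYbar (behavior p w)) pq.
by apply: funext => w; apply: (bij_inj (bitYbar_bij E)); exact: pq.
Qed.

Lemma behavior_is_hom Q w : is_hom (fun q : Q => behavior q w).
Proof.
elim: w => [|a w IH]; first exact: hom_is (ca_out Q).
exact: hom_is (hcomp (Hom IH) (ca_gamma Q a)).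
Qed.

Lemma behavior_ap Q (o : op C) u (w : seq X0) :
  behavior (ap Q o u) w = ap (Ybar E) o (fun i => behavior (u i) w).
Proof. exact: (behavior_is_hom Q w).1. Qed.

Lemma coalg_hom_behavior P Q (h : coalg_hom P Q) p :
  behavior (h p) = behavior p.
Proof.
apply: funext => w; elim: w p => [|a w IH] p; first exact: ch_out.
by rewrite /behavior/= -ch_gamma; exact: IH.
Qed.

Lemma coalg_hom_accepted P Q (h : coalg_hom P Q) p :
  accepted (h p) =1 accepted p.
Proof. by apply/eq_accepted; exact: coalg_hom_behavior. Qed.

Lemma language_coalg_shift_is_hom (a : X0) :
  @is_hom C (power (Ybar E) (seq X0)) (power (Ybar E) (seq X0))
    (fun K => fun w => K (a :: w)).
Proof. by split=> // f g fg w; exact: fg. Qed.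

(* The final coalgebra of all (not necessarily regular) languages. *)
Definition language_coalg : coalg E X0 :=
  @Coalg C D E X0 (power (Ybar E) (seq X0))
    (fun a => Hom (language_coalg_shift_is_hom a))
    (Hom (@power_proj_is_hom C (Ybar E) (seq X0) [::])).

Lemma behavior_hom_is_hom Q :
  @is_hom C Q language_coalg (fun q => behavior q).
Proof.
split=> [o u|x y xy w]; first by apply: funext => w; exact: behavior_ap.
exact: (behavior_is_hom Q w).2.
Qed.

Definition behavior_hom Q : coalg_hom Q language_coalg :=
  @CoalgHom C D E X0 Q language_coalg (Hom (behavior_hom_is_hom Q))
    (fun a x => erefl) (fun x => erefl).

Section Subcoalgebra.
Variables (Q : coalg E X0) (S : set Q) (Ssub : subalgebra S).
Hypothesis Sgamma : forall a x, S x -> S (ca_gamma Q a x).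

Definition sub_coalg : coalg E X0 :=
  @Coalg C D E X0 (subobj Ssub)
    (fun a => corestr Ssub (f := hcomp (ca_gamma Q a) (subobj_incl Ssub))
                (fun x => Sgamma a (svalP x)))
    (hcomp (ca_out Q) (subobj_incl Ssub)).

Definition sub_coalg_incl : coalg_hom sub_coalg Q :=
  @CoalgHom C D E X0 sub_coalg Q (subobj_incl Ssub) (fun a x => erefl)
    (fun x => erefl).

Definition sub_coalg_corestr P (h : coalg_hom P Q) (Sh : forall x, S (h x)) :
  coalg_hom P sub_coalg.
Proof.
refine (@CoalgHom C D E X0 P sub_coalg (corestr Ssub Sh) _ _).
- by move=> a x; apply: (@subobj_incl_inj _ _ _ Ssub); exact: ch_gamma.
- by move=> x; exact: ch_out.
Defined.

End Subcoalgebra.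

Definition generated_coalg Q (G : set Q)
    (Ggamma : forall a x, G x -> G (ca_gamma Q a x)) : coalg E X0 :=
  sub_coalg (@generated_subalgebra _ Q G)
    (fun a => generated_stable (Ggamma a)).

Definition accepted_inj Q :=
  forall x y : Q, accepted x =1 accepted y -> x = y.

(** A state of [Q] with the language of [p] is unique, so any choice of such states commutes with
    operations and transitions. Monotonicity is automatic because the order on [P] is equality. *)
Lemma coalg_hom_of_languages P Q : is_ordered C = false ->
  accepted_inj Q -> (forall p : P, contains Q (accepted p)) ->
  exists h : coalg_hom P Q, forall p, accepted (h p) =1 accepted p.
Proof.
move=> C_unordered Qinj PQ.
have [h hP] := choice PQ.
have h_hom : is_hom h.
  apply: (unordered_is_hom C_unordered) => o u.
  apply: Qinj; apply: ftrans (hP _) _; apply/eq_accepted/funext => w.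
  rewrite !behavior_ap; congr (ap _ o _); apply: funext => i /=.
  by have /eq_accepted -> := hP (u i).
have h_gamma a x : h (ca_gamma P a x) = ca_gamma Q a (h x).
  by apply: Qinj => w; rewrite hP; exact: esym (hP x (a :: w)).
have h_out x : ca_out Q (h x) = ca_out P x.
  by apply: (bij_inj (bitYbar_bij E)); exact: (hP x [::]).
by exists (@CoalgHom _ _ _ _ P Q (Hom h_hom) h_gamma h_out).
Qed.

(** Operations act pointwise on languages, hence commute with any reindexing [h] of words. With
    [rcons^~ a] this extends right derivatives from generators to all states; with [id] it extends
    inclusions. *)
Lemma contains_ap P Q (h : seq X0 -> seq X0) (o : op C)
    (u : 'I_(arity o) -> P) :
  (forall i, contains Q (accepted (u i) \o h)) ->
  contains Q (accepted (ap P o u) \o h).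
Proof.
move=> uP; have [x xP] := choice uP.
exists (ap Q o x) => w.
rewrite /= /accepted -/(behavior _ _) -/(behavior _ _) !behavior_ap.
congr (bitYbar (ap _ o _)); apply: funext => k.
by apply: (bij_inj (bitYbar_bij E)); exact: xP.
Qed.

End Coalgebras.

(** * States and local subcoalgebras of the rational coalgebra *)

Section Rational.
Variables (C D : variety) (E : predual C D) (X0 : finType).
Variable R : rational_coalgebra E X0.
Hypothesis C_locally_finite : locally_finite C.

Lemma rho_generated (r : R) :
  generated [set r | exists (Q : coalg E X0) (finQ : finite_set [set: Q]) x,
                rho_in R finQ x = r] r.
Proof.
set G := (X in generated X).
have Ggamma a x : G x -> G (ca_gamma R a x).
  move=> [Q [finQ [q <-]]]; exists Q, finQ, (ca_gamma Q a q).
  exact: ch_gamma.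
pose i := sub_coalg_incl (@generated_subalgebra _ R G)
  (fun a => generated_stable (Ggamma a)).
have GQ (Q : coalg E X0) (finQ : finite_set [set: Q]) x :
  generated G (rho_in R finQ x) by apply: generated_sub; exists Q, finQ, x.
pose d Q finQ := sub_coalg_corestr (@generated_subalgebra _ R G)
  (fun a => generated_stable (Ggamma a)) (GQ Q finQ).
have [|u [uE _]] := @rho_universal _ _ _ _ R _ d.
  move=> P Q finP finQ h x.
  apply: (@subobj_incl_inj _ _ _ (@generated_subalgebra _ R G)).
  exact: rho_cocone.
have [v [_ v_uniq]] := rho_universal R (@rho_cocone _ _ _ _ R).
have iu_gamma a x : i (u (ca_gamma R a x)) = ca_gamma R a (i (u x)).
  by rewrite !ch_gamma.
have iu_out x : ca_out R (i (u x)) = ca_out R x by rewrite !ch_out.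
pose iu := @CoalgHom _ _ _ _ R R (hcomp i u) iu_gamma iu_out.
pose idR := @CoalgHom _ _ _ _ R R (hid R) (fun a x => erefl) (fun x => erefl).
(* Both [iu] and the identity mediate the canonical cocone, so they agree by uniqueness; hence the
   generated subcoalgebra is everything. *)
have -> : r = i (u r).
  rewrite -[LHS]/(idR r) -[RHS]/(iu r) !v_uniq //.
  by move=> Q finQ x; rewrite /= uE.
exact: svalP (u r).
Qed.

(** It suffices that the union of the images is closed under operations. The finitely many operands
    come from finitely many finite coalgebras, whose images generate a finite subcoalgebra [F]
    containing the result. *)
Lemma rho_in_jointly_surj (r : R) :
  exists (Q : coalg E X0) (finQ : finite_set [set: Q]) x, rho_in R finQ x = r.
Proof.
have := rho_generated r (P := [set r | exists (Q : coalg E X0)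
  (finQ : finite_set [set: Q]) x, rho_in R finQ x = r]).
apply=> // o u uP.
(* Coalgebra, finiteness proof and state are packed into one dependent pair, so that a single choice
   covers all operands. *)
have /choice[t tE] i : exists t :
    {Q : {Q : coalg E X0 | finite_set [set: Q]} & sval Q},
    rho_in R (proj2_sig (projT1 t)) (projT2 t) = u i.
  have [Q [finQ [q qE]]] := uP i.
  exists (existT
    (fun T : {Q : coalg E X0 | finite_set [set: Q]} => sval T : Type)
    (exist _ Q finQ) q).
  exact: qE.
pose Q i := sval (projT1 (t i)).
pose finQ i : finite_set [set: Q i] := proj2_sig (projT1 (t i)).
pose G := \bigcup_(i in [set: 'I_(arity o)]) range (rho_in R (finQ i)).
have finG : finite_set G.
  by apply: bigcup_finite => // i _; apply: finite_image; exact: finQ.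
have Ggamma a x : G x -> G (ca_gamma R a x).
  move=> [i _ [y _ <-]]; exists i => //.
  by exists (ca_gamma (Q i) a y) => //; exact: ch_gamma.
have finF := finite_generated C_locally_finite finG.
pose F := generated_coalg Ggamma.
(* The colimit injection of [F] is the inclusion: on generators by the cocone condition, and
   elsewhere because both maps are homomorphisms. *)
have inF (x : F) : rho_in R (Q := F) finF x = sval x.
  apply: (@subobj_generated_ind _ _ G
    [set x | rho_in R (Q := F) finF x = sval x]) x => [x Gx|p v vP].
    have [i _ [y _ yx]] := Gx.
    have GQ z : generated G (rho_in R (finQ i) z).
      by apply: generated_sub; exists i => //; exists z.
    pose k := sub_coalg_corestr (@generated_subalgebra _ R G)
      (fun a => generated_stable (Ggamma a)) GQ.
    have kE : k y = exist _ x (generated_sub Gx) by apply: eq_exist.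
    by rewrite /= -kE rho_cocone.
  rewrite /= hom_ap; congr (ap R p _); apply: funext => i; exact: vP.
have uG : generated G (ap R o u).
  apply: generated_subalgebra => i; apply: generated_sub; exists i => //.
  by exists (projT2 (t i)) => //; exact: tE.
by exists F, finF, (exist _ _ uG); exact: inF.
Qed.

Lemma rho_accepted_inj : accepted_inj R.
Proof.
move=> r s /eq_accepted rs.
have [P [finP [p pr]]] := rho_in_jointly_surj r.
have [Q [finQ [q qs]]] := rho_in_jointly_surj s.
pose T := language_coalg E X0.
pose G : set T := range (behavior_hom P) `|` range (behavior_hom Q).
have finG : finite_set G by rewrite finite_setU; split; exact: finite_image.
have Ggamma a K : G K -> G (ca_gamma T a K).
  move=> [[y _ <-]|[y _ <-]]; [left|right].
    by exists (ca_gamma P a y) => //; exact: (ch_gamma (behavior_hom P)).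
  by exists (ca_gamma Q a y) => //; exact: (ch_gamma (behavior_hom Q)).
pose F := generated_coalg Ggamma.
have finF : finite_set [set: F] := finite_generated C_locally_finite finG.
have GP y : generated G (behavior_hom P y).
  by apply: generated_sub; left; exists y.
have GQ y : generated G (behavior_hom Q y).
  by apply: generated_sub; right; exists y.
pose kP : coalg_hom P F := sub_coalg_corestr _ _ GP.
pose kQ : coalg_hom Q F := sub_coalg_corestr _ _ GQ.
(* The cocone condition replaces [p] and [q] by their images in [F], which are the same language. *)
rewrite -pr -qs -(rho_cocone R finP finF kP) -(rho_cocone R finQ finF kQ).
congr (rho_in R _ _); apply: eq_exist => /=.
by rewrite -(coalg_hom_behavior (rho_in R finP)) pr rs -qs coalg_hom_behavior.
Qed.

Lemma subcoalgebra_accepted_inj (V : coalg E X0) :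
  subcoalgebra R V -> accepted_inj V.
Proof.
move=> [m [minj _]] x y xy; apply/minj/rho_accepted_inj => w.
by rewrite !coalg_hom_accepted.
Qed.

Lemma accepted_inj_subcoalgebra (V : coalg E X0) (m : coalg_hom V R) :
  accepted_inj V -> subcoalgebra R V.
Proof.
move=> Vinj; exists m; split=> [x y xy|m' v].
  by apply: Vinj => w; rewrite -(coalg_hom_accepted m) xy coalg_hom_accepted.
by apply: rho_accepted_inj => w; rewrite !coalg_hom_accepted.
Qed.

(** Left derivatives are transitions of [W]; right derivatives exist by closure, one letter at a
    time. *)
Lemma local_variety_derivative (W : coalg E X0) (K : seq X0 -> bool) u v :
  local_variety R W -> contains W K ->
  contains W (fun w => K (u ++ w ++ v)).
Proof.
move=> [_ Wright] [k kK].
have [l lK] : contains W (fun w => K (u ++ w)).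
  elim: u k K kK => [|a u IH] k K kK; first by exists k.
  apply: (IH (ca_gamma W a k) (fun w => K (a :: w))) => w.
  exact: (kK (a :: w)).
elim: v => [|a v [z zK]]; first by exists l => w; rewrite cats0.
have [z' z'K] := Wright z a.
by exists z' => w; rewrite z'K zK cat_rcons.
Qed.

(** Inside [Z], the subalgebra generated by the two-sided derivatives of [K] is closed under
    transitions and right derivatives, and every local variety containing [K] contains its
    generators. *)
Lemma smallest_local_variety_exists (Z : coalg E X0) (K : seq X0 -> bool) :
  local_variety R Z -> contains Z K ->
  exists V, smallest_local_variety R K V.
Proof.
move=> Zlv ZK.
pose G : set Z :=
  [set z | exists u v, accepted z =1 fun w => K (u ++ w ++ v)].
have Gsub := @generated_subalgebra _ Z G.
have Ggamma a z : G z -> G (ca_gamma Z a z).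
  move=> [u [v zK]]; exists (rcons u a), v => w.
  by rewrite cat_rcons; exact: (zK (a :: w)).
pose V := generated_coalg Ggamma.
pose i : coalg_hom V Z := sub_coalg_incl _ _.
have iinj : injective i by exact: subobj_incl_inj.
have Zinj := subcoalgebra_accepted_inj Zlv.1.
have Vinj : accepted_inj V.
  by move=> x y xy; apply/iinj/Zinj => w; rewrite !(coalg_hom_accepted i).
have VK : contains V K.
  have [z zK] := ZK.
  have Gz : G z by exists [::], [::] => w; rewrite zK cats0.
  exists (exist _ z (generated_sub Gz)) => w.
  by rewrite -(coalg_hom_accepted i) -zK.
have [m _] := Zlv.1.
have Vsub : subcoalgebra R V.
  apply: accepted_inj_subcoalgebra Vinj.
  apply: (@CoalgHom _ _ _ _ V R (hcomp m i)) => [a x|x].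
    by rewrite /= !ch_gamma.
  by rewrite /= !ch_out.
exists V; split=> //.
  split=> // x a; move: x; apply: subobj_generated_ind.
    move=> z Gz; have [u [v zK]] := Gz.
    have [z' z'K] := local_variety_derivative u (a :: v) Zlv ZK.
    have Gz' : G z' by exists u, (a :: v).
    exists (exist _ z' (generated_sub Gz')) => w.
    rewrite -!(coalg_hom_accepted i) /= z'K zK.
    by rewrite cat_rcons.
  by move=> o u uP; exact: (contains_ap (h := rcons^~ a) uP).
move=> W Wlv WK; apply: subobj_generated_ind.
  move=> z Gz; have [u [v zK]] := Gz.
  have [z' z'K] := local_variety_derivative u v Wlv WK.
  by exists z' => w; rewrite z'K -zK -(coalg_hom_accepted i).
by move=> o u uP; exact: (contains_ap (h := id) uP).
Qed.

End Rational.

(** * Duality *)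

Section Duality.
Variables (C D : variety) (E : predual C D).
Implicit Types P Q : fobj C.

Lemma hat_faithful P Q (f g : hom P Q) :
  hatM E f =1 hatM E g -> f =1 g.
Proof.
move=> /hom_eq fg x; apply: (can_inj (iso_homK (chk_hat E Q))).
by rewrite !chk_hat_nat fg.
Qed.

Lemma chk_faithful (A B : fobj D) (f g : hom A B) :
  chkM E f =1 chkM E g -> f =1 g.
Proof.
move=> /hom_eq fg x; apply: (can_inj (iso_homK (hat_chk E B))).
by rewrite !hat_chk_nat fg.
Qed.

Lemma hat_full P Q (k : hom (hatO E Q) (hatO E P)) :
  exists f : hom P Q, hatM E f =1 k.
Proof.
exists (hcomp (iso_inv (chk_hat E Q)) (hcomp (chkM E k) (chk_hat E P))).
(* The two morphisms are compared after applying [chkM], where naturality of [chk_hat] evaluates the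
   left one. *)
apply: chk_faithful => y.
rewrite -[y](iso_invK (chk_hat E P)) -chk_hat_nat /=.
by rewrite (iso_invK (chk_hat E Q)).
Qed.

Definition point P (z : P) : hom (Ibar E) P :=
  free_ext (Ibar_free E) (fun _ => z).

Lemma point_genIbar P (z : P) : point z (genIbar E) = z.
Proof. exact: (free_ext_eta (Ibar_free E) (fun _ => z) tt). Qed.

Lemma eq_point P (z : P) (f : hom (Ibar E) P) :
  f (genIbar E) = z -> f =1 point z.
Proof.
by move=> fz; apply: (free_hom_eq (Ibar_free E)) => t; rewrite fz point_genIbar.
Qed.

(* Yoneda: the elements of [P] are the morphisms [Ibar -> P], hence, dually,
   the morphisms from the dual of [P] to [Y]. *)
Definition state_hom P (z : P) : hom (hatO E P) (outY E) :=
  hcomp (outY_dual E) (hatM E (point z)).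

Lemma state_hom_inj P (z z' : P) : state_hom z =1 state_hom z' -> z = z'.
Proof.
move=> zz'; rewrite -(point_genIbar z) -(point_genIbar z').
apply: hat_faithful => x.
exact: (can_inj (iso_homK (outY_dual E))) (zz' x).
Qed.

Lemma state_hom_surj P (g : hom (hatO E P) (outY E)) :
  exists z : P, state_hom z =1 g.
Proof.
have [p pE] := hat_full (hcomp (iso_inv (outY_dual E)) g).
exists (p (genIbar E)) => x.
rewrite /= -(hom_eq (eq_point (erefl (p (genIbar E))))) pE /=.
by rewrite iso_invK.
Qed.

Lemma state_hom_comp P Q (f : hom P Q) (z : P) x :
  state_hom (f z) x = state_hom z (hatM E f x).
Proof.
rewrite /= -hatM_comp.
have fz : hcomp f (point z) (genIbar E) = f z by rewrite /= point_genIbar.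
by rewrite (hom_eq (eq_point fz)).
Qed.

(** Since [bit_compat] concerns only morphisms out of [Ibar], it is applied to [f] composed with the
    point [z]. *)
Lemma state_hom_out P (f : hom P (Ybar E)) (z : P) :
  bitYbar (f z) = bitY (state_hom z (hatM E f (Ybar_dual E (genI E)))).
Proof.
by rewrite -[X in f X](point_genIbar z) (bit_compat (hcomp f (point z)))
  /= hatM_comp.
Qed.

(** * Dual F-algebras of finite coalgebras *)

Variable X0 : finType.
Implicit Types (V W : coalg E X0) (A B : falg E X0).

(** The last letter acts first: duality reverses composition, so this is the order in which a
    coalgebra reading [w] is matched by its dual. *)
Definition reached A (w : seq X0) : A :=
  foldr (fun a x => fa_delta A a x) (fa_init A (genI E)) w.

Lemma hom_reached A B (phi : hom A B) :
  (forall a x, phi (fa_delta A a x) = fa_delta B a (phi x)) ->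
  (forall x, phi (fa_init A x) = fa_init B x) ->
  forall w, phi (reached A w) = reached B w.
Proof. by move=> phid phii; elim=> //= a w IH; rewrite phid IH. Qed.

Lemma accepted_state_hom V (finV : finite_set [set: V]) (v : V) w :
  accepted v w =
  bitY (state_hom (P := FObj finV) v (reached (dual_falg finV) w)).
Proof.
elim: w v => [|a w IH] v; first exact: (@state_hom_out (FObj finV)).
rewrite -[LHS]/(accepted (ca_gamma V a v) w) IH; congr bitY.
exact: (@state_hom_comp (FObj finV) (FObj finV)).
Qed.

Lemma dual_falg_essentially_surj A (finA : finite_set [set: A]) :
  exists (Z : coalg E X0) (finZ : finite_set [set: Z]),
    falg_isomorphic A (dual_falg finZ).
Proof.
(* The dual object is generalized and destructed so that it is literally [FObj finP], the form
   expected by [dual_falg]. *)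
have s := hat_chk E (FObj finA).
move: (chkO _ _) s => -[P finP] s.
pose FP := FObj finP.
have /choice[gamma gammaE] a : exists g : hom P P,
    hatM E (P := FP) (Q := FP) g =1
      hcomp s (hcomp (fa_delta A a) (iso_inv s)).
  exact: (@hat_full FP FP).
have [out outE] : exists g : hom P (Ybar E), hatM E (P := FP) g =1
    hcomp s (hcomp (fa_init A) (iso_inv (Ybar_dual E))).
  exact: (@hat_full FP).
exists (@Coalg _ _ _ _ P gamma out), finP, s; split=> [a x|x].
  by rewrite /= gammaE /= iso_homK.
by rewrite /= outE /= iso_homK.
Qed.

Lemma hat_coalg_hom V W (finV : finite_set [set: V])
    (finW : finite_set [set: W]) (j : coalg_hom V W) :
  let hat_j := hatM E (P := FObj finV) (Q := FObj finW) j in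
  (forall a x, hat_j (fa_delta (dual_falg finW) a x) =
     fa_delta (dual_falg finV) a (hat_j x)) /\
  (forall x, hat_j (fa_init (dual_falg finW) x) =
     fa_init (dual_falg finV) x).
Proof.
pose FV := FObj finV; pose FW := FObj finW.
split=> [a x|x].
  rewrite /= -(@hatM_comp _ _ E FV FW FW) -(@hatM_comp _ _ E FV FV FW).
  have /hom_eq -> // : hcomp (ca_gamma W a) j =1 hcomp j (ca_gamma V a).
  by move=> v /=; rewrite ch_gamma.
rewrite /= -(@hatM_comp _ _ E FV FW).
have /hom_eq -> // : hcomp (ca_out W) j =1 ca_out V.
by move=> v /=; rewrite ch_out.
Qed.

(** Duality sees only finite algebras, so a parallel pair out of the dual is first corestricted to
    the finite subalgebra generated by both ranges. Its dual is a pair of maps into [V], equal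
    because the languages of their values are computed at reached states, which lie in the range of
    [t]. *)
Lemma surj_of_reached V (finV : finite_set [set: V]) (A : obj D)
    (t : hom A (dual_falg finV)) :
  locally_finite D -> epis_surjective D -> accepted_inj V ->
  (forall w, exists x, t x = reached (dual_falg finV) w) -> surj t.
Proof.
move=> lf epi Vinj tw; apply: epi => Z k h kh y.
pose FV := FObj finV.
pose G := range k `|` range h.
have finH : finite_set [set: dual_falg finV] := fobj_fin _.
have finG : finite_set G by rewrite finite_setU; split; exact: finite_image.
have Gk x : generated G (k x) by apply: generated_sub; left; exists x.
have Gh x : generated G (h x) by apply: generated_sub; right; exists x.
pose k' := corestr (@generated_subalgebra _ Z G) Gk.
pose h' := corestr (@generated_subalgebra _ Z G) Gh.
pose B := FObj (finite_generated lf finG).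
pose s := hat_chk E B.
have [kf kfE] := @hat_full _ FV (hcomp s k').
have [hf hfE] := @hat_full _ FV (hcomp s h').
have kfhf : kf =1 hf.
  move=> p; apply: Vinj => w.
  rewrite !(accepted_state_hom finV) !(@state_hom_comp _ FV) kfE hfE.
  have [x <-] := tw w.
  congr (bitY (state_hom p (s _))).
  by apply: (@subobj_incl_inj _ _ _ (@generated_subalgebra _ Z G)); exact: kh.
have : k' y = h' y.
  apply: (can_inj (iso_homK s)).
  by rewrite -[LHS]kfE -[RHS]hfE (hom_eq kfhf).
by case.
Qed.

End Duality.

(** * Syntactic monoids *)

Section SyntacticMonoid.
Variable D : variety.

Lemma hom_factor (A B B' : algebra D) (e : hom A B) (e' : hom A B') :
  surj e' -> (forall x y, ale (e' x) (e' y) -> ale (e x) (e y)) ->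
  exists h : hom B' B, forall x, e x = h (e' x).
Proof.
move=> e'S e'e; have [r rK] := choice e'S.
have re x : e (r (e' x)) = e x.
  by apply: (@ale_anti _ B); apply: e'e; rewrite rK; exact: ale_refl.
have h_hom : is_hom (e \o r).
  split=> [o u|x y xy] /=; last by apply: e'e; rewrite !rK.
  rewrite -(hom_ap e (r \o u)) -[RHS]re; congr (e (r _)).
  by rewrite hom_ap; congr (ap B' o _); apply: funext => i /=; rewrite rK.
by exists (Hom h_hom) => x /=; rewrite re.
Qed.

(** The kernel preorder of [psi] is compatible with multiplication on both sides, so the product of
    [N] descends to [A], independently of the section [r] used to define it. *)
Lemma quotient_dmonoid (N : dmonoid D) (A : obj D) (psi : hom N A) :
  surj psi ->
  (forall x y z, ale (psi x) (psi y) -> ale (psi (mul x z)) (psi (mul y z))) ->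
  (forall x y z, ale (psi x) (psi y) -> ale (psi (mul z x)) (psi (mul z y))) ->
  exists (M : dmonoid D) (e : mhom N M),
    surj e /\ forall x y, ale (e x) (e y) <-> ale (psi x) (psi y).
Proof.
move=> psiS psil psir; have [r rK] := choice psiS.
pose m a b := psi (mul (r a) (r b)).
have psi_eqP x y : psi x = psi y -> ale (psi x) (psi y).
  by move=> ->; exact: ale_refl.
have mE x y : m (psi x) (psi y) = psi (mul x y).
  rewrite /m; apply: (@ale_anti _ A).
    apply: (@ale_trans _ A _ (psi (mul x (r (psi y))))).
      by apply/psil/psi_eqP.
    by apply/psir/psi_eqP.
  apply: (@ale_trans _ A _ (psi (mul x (r (psi y))))).
    by apply/psir/psi_eqP; rewrite rK.
  by apply/psil/psi_eqP; rewrite rK.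
have mA a b c : m a (m b c) = m (m a b) c.
  by rewrite -(rK a) -(rK b) -(rK c) !mE mulA.
have m1 a : m (psi (one N)) a = a by rewrite -(rK a) mE mul1m.
have m1' a : m a (psi (one N)) = a by rewrite -(rK a) mE mulm1.
have mbi : bimorphism m.
  have [mulr_hom mull_hom] := mul_bimorphism N.
  split=> a; split=> [o u|x y xy].
  - pose v := r \o u.
    have -> : u = psi \o v by apply: funext => i /=; rewrite rK.
    rewrite -(rK a) -hom_ap mE (mulr_hom _).1 hom_ap; congr (ap A o _).
    by apply: funext => i /=; rewrite mE.
  - by rewrite -(rK a) -(rK x) -(rK y) !mE; apply: psir; rewrite !rK.
  - pose v := r \o u.
    have -> : u = psi \o v by apply: funext => i /=; rewrite rK.
    rewrite -(rK a) -hom_ap mE (mull_hom _).1 hom_ap; congr (ap A o _).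
    by apply: funext => i /=; rewrite mE.
  - by rewrite -(rK a) -(rK x) -(rK y) !mE; apply: psil; rewrite !rK.
pose M := @DMonoid D A m (psi (one N)) mA m1 m1' mbi.
have psiM x y : psi (mul x y) = m (psi x) (psi y) by rewrite mE.
by exists M, (@MHom D N M psi psiM erefl).
Qed.

(** * The syntactic preorder and the syntactic monoid of a language *)

Variables (C : variety) (E : predual C D) (X0 : finType).
Variable Xs : free_dmonoid D X0.
Variable L : hom Xs (outY E).

Definition context (a b : Xs) : hom Xs (outY E) :=
  hcomp L (hcomp (Hom ((mul_bimorphism Xs).2 b))
                 (Hom ((mul_bimorphism Xs).1 a))).

(** The syntactic preorder (a congruence when [D] is unordered), tested only in contexts made of
    words. *)
Definition syntactic_le (x y : Xs) : Prop := forall u v : seq X0,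
  ale (context (word Xs u) (word Xs v) x) (context (word Xs u) (word Xs v) y).

Lemma context_word u v w :
  context (word Xs u) (word Xs v) (word Xs w) = L (word Xs (u ++ w ++ v)).
Proof. by rewrite catA !word_cat. Qed.

(** Multiplication is a bimorphism and operations are monotone, so the admissible [b], and then the
    admissible [a], form subalgebras; both contain the words, which generate [Xs]. *)
Lemma syntactic_le_context x y : syntactic_le x y ->
  forall a b, ale (context a b x) (context a b y).
Proof.
have [mulr_hom mull_hom] := mul_bimorphism Xs.
move=> xy a b.
apply: (@free_generated _ _ _ _ (word_free Xs)
  [set b | ale (context a b x) (context a b y)]) b => [o v vP|v].
  rewrite /= /context /= !(mulr_hom _).1 !hom_ap.
  exact: ap_mono.
apply: (@free_generated _ _ _ _ (word_free Xs)
  [set a | ale (context a (word Xs v) x) (context a (word Xs v) y)]) a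
  => [o w wP|w]; last exact: xy.
rewrite /= /context /= !(mull_hom _).1 !hom_ap.
exact: ap_mono.
Qed.

(** The factor [z] is absorbed into the right context, which need not be a word any more. *)
Lemma syntactic_le_mull x y z :
  syntactic_le x y -> syntactic_le (mul x z) (mul y z).
Proof.
move=> xy u v.
have := syntactic_le_context xy (word Xs u) (mul z (word Xs v)).
by rewrite /context /= !mulA.
Qed.

Lemma syntactic_le_mulr x y z :
  syntactic_le x y -> syntactic_le (mul z x) (mul z y).
Proof.
move=> xy u v.
have := syntactic_le_context xy (mul (word Xs u) z) (word Xs v).
by rewrite /context /= !mulA.
Qed.

Lemma syntactic_hom_is_hom :
  @is_hom D Xs (power (outY E) (seq X0 * seq X0))
    (fun x uv => context (word Xs uv.1) (word Xs uv.2) x).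
Proof.
split=> [o u|x y xy uv]; last exact: hom_le.
by apply: funext => uv; exact: hom_ap.
Qed.

Lemma recognizes_context (N : dmonoid D) (e : mhom Xs N)
    (g : hom N (outY E)) : (forall x, L x = g (e x)) ->
  forall x y, ale (e x) (e y) -> syntactic_le x y.
Proof.
have [mulr_hom mull_hom] := mul_bimorphism N.
move=> Lg x y xy u v; rewrite /context /= !Lg !mhom_mul.
by apply: hom_le; apply: (mull_hom _).2; apply: (mulr_hom _).2.
Qed.

Lemma syntactic_exists : exists (M : dmonoid D) (e : mhom Xs M),
  is_syntactic L e /\ forall x y, syntactic_le x y -> ale (e x) (e y).
Proof.
pose P := range (Hom syntactic_hom_is_hom).
have Psub : subalgebra P by exact: subalgebra_image.
pose psi := corestr Psub (fun x => imageT (Hom syntactic_hom_is_hom) x).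
have psi_le x y : ale (psi x) (psi y) <-> syntactic_le x y.
  by split=> xy; [move=> u v; exact: (xy (u, v))|move=> [u v]; exact: xy].
have psiS : surj psi.
  by move=> [y yP]; have [x _ xy] := yP; exists x; apply: eq_exist.
have [||M [e [eS ele]]] := quotient_dmonoid psiS.
  by move=> x y z /psi_le xy; apply/psi_le/syntactic_le_mull.
  by move=> x y z /psi_le xy; apply/psi_le/syntactic_le_mulr.
exists M, e; split; last by move=> x y xy; apply/ele/psi_le.
split=> //.
  have [|g gE] := @hom_factor _ _ _ L e eS; last by exists g.
  move=> x y /ele /psi_le /(_ [::] [::]).
  by rewrite /context /= word_nil !mul1m !mulm1.
move=> N e' e'S [g Lg].
have [|h hE] := @hom_factor _ _ _ e e' e'S.
  by move=> x y xy; apply/ele/psi_le; exact: (recognizes_context Lg).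
have hM x y : h (mul x y) = mul (h x) (h y).
  have [x' <-] := e'S x; have [y' <-] := e'S y.
  by rewrite -mhom_mul -!hE mhom_mul.
have h1 : h (one N) = one M by rewrite -(mhom_one e') -hE mhom_one.
by exists (@MHom D N M h hM h1).
Qed.

(** By universality [e] factors through the concrete model [e0], where the claim holds by
    construction; the factor is monotone. *)
Lemma syntactic_le_syntactic (M : dmonoid D) (e : mhom Xs M) :
  is_syntactic L e -> forall x y, syntactic_le x y -> ale (e x) (e y).
Proof.
move=> [_ _ e_univ] x y xy.
have [M0 [e0 [[e0S e0L _] e0_le]]] := syntactic_exists.
have [h hE] := e_univ M0 e0 e0S e0L.
by rewrite !hE; apply: hom_le; exact: e0_le.
Qed.

(** The image of a word in [M] depends only on the transformation of [Q] it induces. So the images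
    of words form a finite set, and they generate [M]. *)
Lemma syntactic_finite (M : dmonoid D) (e : mhom Xs M) :
  locally_finite D -> regular L -> is_syntactic L e -> finite_set [set: M].
Proof.
move=> lf [Q [delta [i [f Lf]]]] esyn.
have [eS _ _] := esyn.
apply: lf; exists (range (fun w => e (word Xs w))); split; last first.
  move=> P GP Psub m _; have [x <-] := eS m.
  apply: (@free_generated _ _ _ _ (word_free Xs) (e @^-1` P)) => [|w].
    exact: subalgebra_preimage.
  by apply: GP; exists w.
pose act (w : seq X0) (q : Q) : Q := foldl (fun q a => delta a q) q w.
have act_e w w' : act w = act w' -> e (word Xs w) = e (word Xs w').
  move=> ww'; apply: (@ale_anti _ M);
  apply: (syntactic_le_syntactic esyn) => u v; rewrite !context_word !Lf;
  rewrite !foldl_cat -/(act w _) -/(act w' _) ww'; exact: ale_refl.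
(* Transformations induced by no word get the unit as a default value. *)
have /choice[F FE] T : exists m, forall w, act w = T -> e (word Xs w) = m.
  have [[w wT]|noT] := pselect (exists w, act w = T).
    by exists (e (word Xs w)) => w' w'T; apply: act_e; rewrite w'T.
  by exists (one M) => w wT; case: noT; exists w.
apply: (sub_finite_set _ (finite_image F
  (finite_fun (fobj_fin Q) (fobj_fin Q)))).
by move=> _ [w _ <-]; exists (act w) => //; rewrite (FE (act w) w).
Qed.

Lemma reached_derived (M : dmonoid D) (e : mhom Xs M) w :
  reached (derived_falg E e) w = e (word Xs (rev w)).
Proof.
elim: w => [|a w IH].
  rewrite /reached /= (free_ext_eta (unitI_free E) (fun=> one M) tt).
  by rewrite word_nil mhom_one.
by rewrite [LHS]/= -/(reached _ _) IH -mhom_mul -word_cat rev_cons cats1.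
Qed.

(** * The coalgebra dual to a finite quotient monoid *)

Section DualOfQuotient.
Variables (M : dmonoid D) (e : mhom Xs M) (eS : surj e).
Variables (Z : coalg E X0) (finZ : finite_set [set: Z]).
Variables (s : iso (derived_falg E e) (dual_falg finZ)).
Hypothesis s_reached : forall w,
  s (reached (derived_falg E e) w) = reached (dual_falg finZ) w.

Lemma dual_accepted (z : Z) w : accepted z w =
  bitY (state_hom E (P := FObj finZ) z (s (e (word Xs (rev w))))).
Proof. by rewrite (accepted_state_hom finZ) -s_reached reached_derived. Qed.

Lemma dual_accepts (g : hom M (outY E)) :
  exists z : Z, forall w, accepted z w = bitY (g (e (word Xs (rev w)))).
Proof.
have [z zE] := @state_hom_surj _ _ E (FObj finZ) (hcomp g (iso_inv s)).
by exists z => w; rewrite dual_accepted zE /= iso_homK.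
Qed.

(** States with equal languages give morphisms to [outY E] that agree on the images of words, hence
    on the image of [Xs], which is everything. *)
Lemma dual_accepted_inj : accepted_inj Z.
Proof.
move=> z z' zz'; apply: (@state_hom_inj _ _ E (FObj finZ)) => x.
rewrite -(iso_invK s x); have [y <-] := eS (iso_inv s x).
apply: (free_hom_eq (word_free Xs)
  (f := hcomp (state_hom E (P := FObj finZ) z) (hcomp s e))
  (g := hcomp (state_hom E (P := FObj finZ) z') (hcomp s e))) => w.
apply: (bij_inj (bitY_bij E)); have := zz' (rev w).
by rewrite !dual_accepted revK.
Qed.

Lemma dual_local_variety (R : rational_coalgebra E X0) :
  locally_finite C -> local_variety R Z.
Proof.
move=> lf; split.
  exact: (accepted_inj_subcoalgebra lf (rho_in R finZ) dual_accepted_inj).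
move=> z a.
(* Words are read backwards, so appending [a] on the right becomes multiplication by the image of
   [a] on the left. *)
pose la := Hom ((mul_bimorphism M).1 (e (word Xs [:: a]))).
have [z' z'E] := dual_accepts (hcomp (state_hom E (P := FObj finZ) z)
                                     (hcomp s la)).
exists z' => w; rewrite z'E dual_accepted rev_rcons -(cat1s a (rev w)).
by rewrite word_cat mhom_mul.
Qed.

Lemma dual_contains : recognizes e L ->
  contains Z (word_language (reversal L)).
Proof.
move=> [g Lg]; have [z zE] := dual_accepts g.
exists z => w; rewrite zE -Lg /word_language /= /revX.
by rewrite free_ext_eta.
Qed.

End DualOfQuotient.

Lemma dual_of_syntactic (M : dmonoid D) (e : mhom Xs M) :
  finite_set [set: M] ->
  exists (Z : coalg E X0) (finZ : finite_set [set: Z])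
         (s : iso (derived_falg E e) (dual_falg finZ)),
    [/\ forall a x, s (fa_delta (derived_falg E e) a x) =
          fa_delta (dual_falg finZ) a (s x),
        forall x, s (fa_init (derived_falg E e) x) =
          fa_init (dual_falg finZ) x &
        forall w, s (reached (derived_falg E e) w) =
          reached (dual_falg finZ) w].
Proof.
move=> finM.
have [Z [finZ [s [sd si]]]] :=
  @dual_falg_essentially_surj _ _ E X0 (derived_falg E e) finM.
by exists Z, finZ, s; split=> //; exact: hom_reached.
Qed.

End SyntacticMonoid.

Theorem theorem6p9 (C D : variety)
  (D_commutative : commutative_variety D)
  (D_locally_finite : locally_finite D)
  (D_epis : epis_surjective D)
  (C_unordered : is_ordered C = false)
  (C_locally_finite : locally_finite C)
  (E : predual C D)
  (X0 : finType)
  (Xs : free_dmonoid D X0)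
  (R : rational_coalgebra E X0)
  (L : hom Xs (outY E))
  (L_regular : regular L) :
  (exists V : coalg E X0,
      smallest_local_variety R (word_language (reversal L)) V) /\
  (exists (M : dmonoid D) (e : mhom Xs M), is_syntactic L e) /\
  (forall (V : coalg E X0) (M : dmonoid D) (e : mhom Xs M),
      smallest_local_variety R (word_language (reversal L)) V ->
      is_syntactic L e ->
      exists V_finite : finite_set [set: V],
        falg_isomorphic (dual_falg V_finite) (derived_falg E e)).
Proof.
have [M0 [e0 [e0syn _]]] := syntactic_exists L.
split.
  have [e0S e0L _] := e0syn.
  have finM0 := syntactic_finite D_locally_finite L_regular e0syn.
  have [Z [finZ [s [_ _ sr]]]] := @dual_of_syntactic _ _ E _ _ _ e0 finM0.
  apply: (smallest_local_variety_exists C_locally_finite (Z := Z)).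
    exact: (dual_local_variety e0S sr).
  exact: (dual_contains sr).
split; first by exists M0, e0.
move=> V M e [Vlv [v0 v0L] Vmin] esyn; have [eS eL _] := esyn.
have finM := syntactic_finite D_locally_finite L_regular esyn.
have [Z [finZ [s [sd si sr]]]] := @dual_of_syntactic _ _ E _ _ _ e finM.
have Zinj := dual_accepted_inj eS sr.
have Vinj := subcoalgebra_accepted_inj C_locally_finite Vlv.1.
have Zlv := dual_local_variety eS sr R C_locally_finite.
have [j jE] := coalg_hom_of_languages C_unordered Zinj
  (Vmin Z Zlv (dual_contains sr eL)).
have finV : finite_set [set: V].
  rewrite -(preimage_setT j); apply: finite_preimage => // x y _ _ xy.
  by apply: Vinj => w; rewrite -jE xy jE.
exists finV.
pose FV := FObj finV; pose FZ := FObj finZ.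
pose t : hom M (dual_falg finV) := hcomp (hatM E (P := FV) (Q := FZ) j) s.
have [j_delta j_init] := hat_coalg_hom finV finZ j.
have t_word w : t (e (word Xs w)) = reached (dual_falg finV) (rev w).
  rewrite -(hom_reached (B := dual_falg finV) j_delta j_init) -sr.
  by rewrite reached_derived revK.
have tS : surj t.
  apply: (surj_of_reached D_locally_finite D_epis Vinj) => w.
  by exists (e (word Xs (rev w))); rewrite t_word revK.
have tE m m' : ale (t m) (t m') -> ale m m'.
  have [x <-] := eS m; have [y <-] := eS m'.
  move=> xy; apply: (syntactic_le_syntactic esyn) => u v.
  (* The context [(u, v)] of [L] is the derivative of the reversed language by [rev v] on the left
     and [rev u] on the right; the state [k] accepts it, so this coordinate factors through [t]. *)
  have [k kE] := local_variety_derivative (rev v) (rev u) Vlv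
    (ex_intro _ v0 v0L).
  have contextE z : context L (word Xs u) (word Xs v) z =
      state_hom E (P := FV) k (t (e z)).
    apply: (free_hom_eq (word_free Xs)
      (g := hcomp (state_hom E (P := FV) k) (hcomp t e))) => w.
    apply: (bij_inj (bitY_bij E)).
    rewrite -[hcomp _ _ _]/(state_hom E (P := FV) k (t (e (word Xs w)))).
    rewrite context_word t_word -(accepted_state_hom finV) kE.
    rewrite /word_language /= /revX free_ext_eta.
    by rewrite !rev_cat !revK catA.
  by rewrite !contextE; exact: hom_le.
have [phi phiK] := iso_of_surj_embedding tS tE.
have tK : cancel phi t by move=> x; have [y <-] := tS x; rewrite phiK.
exists phi; split=> [a x|x].
  have [y <-] := tS x; rewrite phiK -[RHS]phiK; congr (phi _).
  by rewrite /t /= sd j_delta.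
rewrite -[RHS]phiK; congr (phi _).
by rewrite /t /= si j_init.
Qed.
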